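(* The observed process $\{S_t:t\in\mathbb{R}^+\}$ of a continuous-time three-state hidden Markov model is irreversible if and only if the underlying Markov process $\{C_t\}$ is irreversible and the state-dependent probability matrix $\Pi$ is regular.
   Context: Continuous-time three-state hidden Markov model: $\{C_t:t\in\mathbb{R}^+\}$ is an irreducible, time-homogeneous Markov process on the three states $\{1,2,3\}$ with transition rate matrix $Q=(q_{ij})$, started from its stationary distribution $\mu=(\mu_1,\mu_2,\mu_3)$, $\mu_i>0$, $\sum_i\mu_i=1$. The state-dependent probability matrix $\Pi=(\pi(k\,|\,i))$, $i=1,2,3$, $k=0,\dots,K-1$, is a $3\times K$ matrix with nonnegative entries and rows summing to 1; $\varphi_k\in\mathbb{R}^3$ is its column indexed by $k$. The observed process $\{S_t\}$ takes values in $\{0,\dots,K-1\}$; conditionally on the hidden state at time $t$, $S_t$ has law $\pi(\cdot\,|\,C_t)$ and is independent of all earlier observations and of the hidden process before time $t$. Thus for $0\le t_1<\cdots<t_n$, $\Pr(S_{t_1}=s_1,\dots,S_{t_n}=s_n)=\mu\Lambda_{s_1}P(t_2-t_1)\Lambda_{s_2}\cdots P(t_n-t_{n-1})\Lambda_{s_n}\vec e$, where $P(t)=e^{tQ}$, $\Lambda_k=\mathrm{diag}(\varphi_k)$, $\vec e=(1,1,1)'$. The underlying process is reversible if $\mu_iq_{ij}=\mu_jq_{ji}$ for all $i,j$ (detailed balance), and irreversible otherwise. The observed process is reversible if for all positive integers $n$, all $0\le t_1\le\cdots\le t_n$ and all $s_1,\dots,s_n$, $\Pr(S_{t_1}=s_1,\dots,S_{t_n}=s_n)=\Pr(S_{t_1^-}=s_1,\dots,S_{t_n^-}=s_n)$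 with $t_k^-=t_1+t_n-t_k$; otherwise it is irreversible. $\Pi$ is regular if no two of its three rows are equal as vectors; otherwise it is singular. *)

(* Defs.v *)
From HB Require Import structures.
From mathcomp Require Import all_boot all_order all_algebra.
From mathcomp Require Import all_classical all_reals all_analysis.
Import Order.TTheory GRing.Theory Num.Theory.
Import numFieldNormedType.Exports.

Set Implicit Arguments.
Unset Strict Implicit.
Unset Printing Implicit Defensive.

Local Open Scope classical_set_scope.
Local Open Scope ring_scope.

Definition mx_exp (R : realType) (n : nat) (A : 'M[R]_n.+1) : 'M[R]_n.+1 :=
  limn (series (fun k : nat => (k`!%:R)^-1 *: A ^+ k)).

Definition transition (R : realType) (Q : 'M[R]_3) (t : R) : 'M[R]_3 :=
  mx_exp (t *: Q).

Definition rate_matrix (R : realType) (Q : 'M[R]_3) : Prop :=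
  (forall i j, i != j -> 0 <= Q i j) /\ (forall i, \sum_j Q i j = 0).

Definition irreducible_rates (R : realType) (Q : 'M[R]_3) : Prop :=
  forall i j, connect (fun x y => 0 < Q x y) i j.

Definition positive_distribution (R : realType) (mu : 'rV[R]_3) : Prop :=
  (forall i, 0 < mu 0 i) /\ \sum_i mu 0 i = 1.

Definition stationary (R : realType) (Q : 'M[R]_3) (mu : 'rV[R]_3) : Prop :=
  forall t, 0 <= t -> mu *m transition Q t = mu.

(* [Pi i k] is the probability pi(k | i) of observing k in hidden state i. *)
Definition stochastic (R : realType) (K : nat) (Pi : 'M[R]_(3, K)) : Prop :=
  (forall i k, 0 <= Pi i k) /\ (forall i, \sum_k Pi i k = 1).

Definition path_event (T : Type) (R : realType) (E : Type)
    (X : R -> T -> E) (n : nat) (t : 'I_n -> R) (x : 'I_n -> E) : set T :=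
  [set w | forall k, X (t k) w = x k].

(* Processes are indexed by R, but only their values at nonnegative times are
   constrained.  Conditional probabilities are written multiplicatively, so
   that no conditioning event needs to have positive probability.  The times
   t_1, ..., t_n of a history are not assumed to be ordered (only to precede
   the present), and n = 0 gives the empty history.  In the Markov property
   the history contains the observations as well as the hidden states: the
   Markov property of C with respect to its own history alone would not give
   the product formula for the joint law of S, since the jumps of C could
   depend on past observations. *)
Record hidden_markov_model (R : realType) (d : measure_display)
    (T : measurableType d) (P : probability T R) (K : nat)
    (Q : 'M[R]_3) (mu : 'rV[R]_3) (Pi : 'M[R]_(3, K))
    (C : R -> T -> 'I_3) (S : R -> T -> 'I_K) : Prop := {
  hmm_rates : rate_matrix Q;
  hmm_irreducible : irreducible_rates Q;
  hmm_positive : positive_distribution mu;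
  hmm_stationary : stationary Q mu;
  hmm_stochastic : stochastic Pi;
  hmm_measurable_hidden : forall t i, 0 <= t ->
    measurable (C t @^-1` [set i]);
  hmm_measurable_observed : forall t s, 0 <= t ->
    measurable (S t @^-1` [set s]);
  hmm_initial : forall i, P (C 0 @^-1` [set i]) = (mu 0 i)%:E;
  hmm_markov : forall (n : nat) (t : 'I_n -> R) (c : 'I_n -> 'I_3)
      (s : 'I_n -> 'I_K) (u v : R) (i j : 'I_3) (k : 'I_K),
    (forall l, 0 <= t l < u) -> 0 <= u < v ->
    let past := path_event C t c `&` path_event S t s in
    let present := C u @^-1` [set i] `&` S u @^-1` [set k] in
    P (past `&` present `&` C v @^-1` [set j]) =
      (P (past `&` present) * (transition Q (v - u) i j)%:E)%E;
  hmm_emission : forall (n : nat) (t : 'I_n -> R) (c : 'I_n -> 'I_3)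
      (s : 'I_n -> 'I_K) (u : R) (i : 'I_3) (k : 'I_K),
    (forall l, 0 <= t l < u) -> 0 <= u ->
    let past := path_event C t c `&` path_event S t s in
    P (past `&` C u @^-1` [set i] `&` S u @^-1` [set k]) =
      (P (past `&` C u @^-1` [set i]) * (Pi i k)%:E)%E
}.

Definition underlying_reversible (R : realType) (Q : 'M[R]_3)
    (mu : 'rV[R]_3) : Prop :=
  forall i j, mu 0 i * Q i j = mu 0 j * Q j i.

Definition underlying_irreversible (R : realType) (Q : 'M[R]_3)
    (mu : 'rV[R]_3) : Prop :=
  ~ underlying_reversible Q mu.

(* Times may coincide, hence the use of events of the process itself rather
   than of the product formula, which only holds for distinct times. *)
Definition observed_reversible (R : realType) (d : measure_display)
    (T : measurableType d) (P : probability T R) (K : nat)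
    (S : R -> T -> 'I_K) : Prop :=
  forall (n : nat) (t : 'I_n.+1 -> R) (s : 'I_n.+1 -> 'I_K),
    0 <= t ord0 -> (forall k l : 'I_n.+1, (k <= l)%N -> t k <= t l) ->
    P (path_event S t s) =
      P (path_event S (fun k => t ord0 + t ord_max - t k) s).

Definition observed_irreversible (R : realType) (d : measure_display)
    (T : measurableType d) (P : probability T R) (K : nat)
    (S : R -> T -> 'I_K) : Prop :=
  ~ observed_reversible P S.

Definition regular (R : realType) (K : nat) (Pi : 'M[R]_(3, K)) : Prop :=
  forall i j, i != j -> row i Pi <> row j Pi.

(* Main.v *)
Require Import Defs.
From HB Require Import structures.
From mathcomp Require Import all_boot all_order all_algebra.
From mathcomp Require Import all_classical all_reals all_analysis.
From mathcomp Require Import ring lra.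
Import Order.TTheory GRing.Theory Num.Theory.
Import numFieldNormedType.Exports.

(** Write [p t] for the transition matrices, [D] for [diag_mx mu] and [L k] for
    the diagonal matrix of emission probabilities of the symbol [k].  The
    probability of observing [s_1, ..., s_n] at distinct times is
    [mu L_(s_1) p(t_2 - t_1) L_(s_2) ... L_(s_n) 1].  Transposing this scalar and
    moving [D] from one end to the other shows that reading the observations
    backwards amounts to replacing [p] by the dual semigroup
    [p' t = D^-1 (p t)^T D]  ([filter_time_reversal]).  Hence the observed process
    is reversible as soon as [p] and [p'] give the same probabilities
    ([observed_reversible_of_dual]).

    There are two reasons for which they do.  If detailed balance holds for the
    rates, it holds for [p t], that is, [p' = p].  If two rows of [Pi] agree, every
    [L k] is a combination of the identity and of the projection on the remaining
    state [h]; expanding the product, the observations only test visits to [h],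
    so that its value depends on [p] through the return probabilities [p t h h]
    alone ([filter_single_state]), and [p' t h h = p t h h].

    Conversely, suppose that the observed process is reversible and that the rows
    of [Pi] are distinct.  Some combination of the columns of [Pi] is a vector [f]
    with three distinct entries.  Reversibility at the times [0, t, t + s] gives by
    multilinearity [mu F p(t) F p(s) F 1 = mu F p(s) F p(t) F 1] with
    [F = diag_mx f], and letting [s] tend to [0],
    [mu F p(t) F^2 1 = mu F^2 p(t) F 1].  The matrix [D p(t)] minus its transpose is
    antisymmetric with zero row sums, so on three states it is a multiple [g] of one
    fixed matrix, and the last identity reads [g * V = 0] for the Vandermonde
    determinant [V] of [f] ([circulation3_symmetric]).  Thus [g = 0], which is detailed
    balance for [p t]; differentiating at [t = 0] gives it for the rates.

    The exponential of a matrix enters only through its entries, which are power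
    series in [t] with coefficients dominated by those of an exponential.  The
    semigroup law is obtained from the Markov property itself, by conditioning on
    the hidden state at an intermediate time. *)

Set Implicit Arguments.
Unset Strict Implicit.
Unset Printing Implicit Defensive.

Local Open Scope classical_set_scope.
Local Open Scope ring_scope.

(** * Forward and backward recursions for the law of the observations *)

(** The unnormalized filter of a hidden Markov chain: the row vector of the joint
    probabilities of the observations in [l] and of each hidden state at time [t].
    Lists of observations that are conditioned on are written newest first, so
    that a new observation is added at the head. *)
Fixpoint filter_before {R : pzRingType} {n : nat} {A : Type} (mu : 'rV[R]_n)
    (L : A -> 'M[R]_n) (p : R -> 'M[R]_n) (t : R) (l : seq (R * A)) : 'rV[R]_n :=
  if l is x :: l' then filter_before mu L p x.1 l' *m L x.2 *m p (t - x.1)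
  else mu.

(** The adjoint of the filter: the probability, as a function of the hidden state
    at time [t], of the later observations in [l], here written oldest first. *)
Fixpoint likelihood_after {R : pzRingType} {n : nat} {A : Type}
    (L : A -> 'M[R]_n) (p : R -> 'M[R]_n) (t : R) (l : seq (R * A)) : 'cV[R]_n :=
  if l is x :: l' then p (x.1 - t) *m L x.2 *m likelihood_after L p x.1 l'
  else const_mx 1.

(** Both sides are the probability of the same observations, cut at [x] on the
    left and read entirely forwards on the right; each step moves one observation
    from the future to the past.  The time [u] is arbitrary because a stochastic
    kernel preserves total mass. *)
Lemma filter_mul_likelihood (R : pzRingType) (n : nat) (A : Type) (mu : 'rV[R]_n)
    (L : A -> 'M[R]_n) (p : R -> 'M[R]_n) (x : R * A) (past future : seq (R * A))
    (u : R) :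
  (forall t, p t *m const_mx 1 = const_mx 1 :> 'cV_n) ->
  filter_before mu L p x.1 past *m L x.2 *m likelihood_after L p x.1 future =
  filter_before mu L p u (catrev future (x :: past)) *m const_mx 1.
Proof.
move=> p1; elim: future x past => [|y future IH] x past /=.
  by rewrite -(mulmxA (_ *m _) (p _)) p1.
by rewrite -IH /= !mulmxA.
Qed.

(** The transpose of the filter of the dual semigroup is, up to the factor
    [diag_mx mu], the likelihood of the reversed observations: the factor commutes
    with the emission matrices and exchanges [p'] transposed with [p]. *)
Lemma filter_time_reversal (R : realFieldType) (n : nat) (A : Type)
    (mu : 'rV[R]_n) (L : A -> 'rV[R]_n) (p p' : R -> 'M[R]_n) (a t u : R)
    (l : seq (R * A)) :
  (forall s, 0 <= s -> (p' s)^T *m diag_mx mu = diag_mx mu *m p s) ->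
  (forall s, p s *m const_mx 1 = const_mx 1 :> 'cV_n) ->
  (forall s, 0 <= s -> mu *m p s = mu) ->
  path >%R t (unzip1 l) ->
  filter_before mu (fun k => diag_mx (L k)) p' t l *m const_mx 1 =
  filter_before mu (fun k => diag_mx (L k)) p u (rev [seq (a - x.1, x.2) | x <- l])
    *m const_mx 1 :> 'M[R]_1.
Proof.
move=> dual p1 mup.
set F := fun k => diag_mx (L k).
have mu1 : (const_mx 1 : 'rV_n) *m diag_mx mu = mu.
  by apply/rowP => j; rewrite mul_mx_diag !mxE mul1r.
have adj : forall l t, path >%R t (unzip1 l) -> (filter_before mu F p' t l)^T =
    diag_mx mu *m likelihood_after F p (a - t) [seq (a - x.1, x.2) | x <- l].
  elim=> [|x {}l IH] {}t /=.
    by move=> _; rewrite -[LHS]trmxK -[RHS]trmxK; congr trmx; rewrite trmxK trmx_mul tr_diag_mx trmx_const.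
  case/andP=> xt xl.
  rewrite !trmx_mul IH // tr_diag_mx.
  rewrite (_ : a - x.1 - (a - t) = t - x.1); last by ring.
  rewrite (mulmxA (diag_mx (L x.2))) diag_mxC -(mulmxA (diag_mx mu)).
  by rewrite (mulmxA (p' _)^T) dual ?subr_ge0 1?ltW // !mulmxA.
move=> tl.
rewrite -[LHS]trmxK; rewrite trmx_mul adj // trmx_const mulmxA mu1.
rewrite [RHS](_ : _ = (mu *m likelihood_after F p (a - t) [seq (a - x.1, x.2) | x <- l])^T^T).
  by rewrite trmxK [LHS]mx11_scalar [RHS]mx11_scalar mxE.
rewrite trmxK; case: l tl => [|x l] /= => [_|/andP[xt _]].
  by [].
rewrite (_ : a - x.1 - (a - t) = t - x.1); last by ring.
rewrite !mulmxA mup ?subr_ge0 1?ltW //.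
by rewrite -(@filter_mul_likelihood R n A mu F p (a - x.1, x.2) [::]).
Qed.

(** By the semigroup law, a filter without observation between [t] and [u] is
    just transported by the kernel. *)
Lemma filter_evolve (R : realFieldType) (n : nat) (A : Type)
    (mu : 'rV[R]_n) (L : A -> 'M[R]_n) (p : R -> 'M[R]_n) (t u : R)
    (l : seq (R * A)) :
  (forall s s', 0 < s -> 0 < s' -> p s *m p s' = p (s + s')) ->
  (forall s, 0 <= s -> mu *m p s = mu) ->
  path >%R t (unzip1 l) -> t < u ->
  filter_before mu L p t l *m p (u - t) = filter_before mu L p u l.
Proof.
move=> pD mup; case: l => [|x l] /=; first by move=> _ tu; rewrite mup // subr_ge0 ltW.
case/andP=> xt _ tu; rewrite -mulmxA pD ?subr_gt0 //.
by congr (_ *m p _); ring.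
Qed.

(** When observations can only tell the state [h] from the others, the total mass of
    the filter and its mass at [h] satisfy a recursion of their own: an observation
    multiplies by [a k] the filter that ignores it, and adds [b k] times the mass at
    [h] restarted from [h].  The kernel enters this recursion only through
    [p s h h]. *)
Lemma filter_single_state (R : realFieldType) (n : nat) (A : Type)
    (mu : 'rV[R]_n) (L : A -> 'M[R]_n) (a b : A -> R) (h : 'I_n)
    (p p' : R -> 'M[R]_n) (t : R) (l : seq (R * A)) :
  (forall k, L k = a k *: 1%:M + b k *: delta_mx h h) ->
  (forall s s', 0 < s -> 0 < s' -> p s *m p s' = p (s + s')) ->
  (forall s s', 0 < s -> 0 < s' -> p' s *m p' s' = p' (s + s')) ->
  (forall s, 0 <= s -> mu *m p s = mu) ->
  (forall s, 0 <= s -> mu *m p' s = mu) ->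
  (forall s, 0 <= s -> p s *m const_mx 1 = const_mx 1 :> 'cV_n) ->
  (forall s, 0 <= s -> p' s *m const_mx 1 = const_mx 1 :> 'cV_n) ->
  (forall s, 0 <= s -> p' s h h = p s h h) ->
  path >%R t (unzip1 l) ->
  filter_before mu L p' t l *m const_mx 1 =
  filter_before mu L p t l *m const_mx 1 :> 'M[R]_1.
Proof.
move=> LE pD pD' mup mup' p1 p1' phh tl.
pose e : 'cV[R]_n := delta_mx h 0.
have deltaE : delta_mx h h = e *m delta_mx 0 h by rewrite mul_delta_mx.
have ehE (q : 'M[R]_n) : delta_mx 0 h *m q *m e = (q h h)%:M.
  by apply/matrixP => i j; rewrite -rowE -colE !mxE !ord1.
(* The recursion for the total mass involves the mass at [h]. *)
suff: filter_before mu L p' t l *m const_mx 1 =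
      filter_before mu L p t l *m const_mx 1 :> 'M[R]_1 /\
      filter_before mu L p' t l *m e = filter_before mu L p t l *m e by case.
elim: l t tl => [|x l IH] t //= /andP[xt xl].
have [IH1 IHe] := IH _ xl.
have step q : (forall s s', 0 < s -> 0 < s' -> q s *m q s' = q (s + s')) ->
   (forall s, 0 <= s -> mu *m q s = mu) -> forall v : 'cV_n,
   filter_before mu L q x.1 l *m L x.2 *m q (t - x.1) *m v =
   a x.2 *: (filter_before mu L q t l *m v) +
   b x.2 *: (filter_before mu L q x.1 l *m e *m (delta_mx 0 h *m q (t - x.1) *m v)).
  move=> qD muq v; rewrite LE mulmxDr mulmxDl mulmxDl; congr (_ + _).
    by rewrite -scalemxAr mulmx1 -!scalemxAl (@filter_evolve R n A mu L q).
  by rewrite -scalemxAr deltaE -!scalemxAl !mulmxA.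
have tl : path >%R t (unzip1 l).
  by case: (l) xl => //= y l' /andP[yx ->]; rewrite (lt_trans yx xt).
have [IHt1 IHte] := IH _ tl.
have xt0 : 0 <= t - x.1 by rewrite subr_ge0 ltW.
rewrite !step //; split.
  by rewrite IHt1 IHe -!mulmxA p1 // p1'.
by rewrite IHte IHe !ehE phh.
Qed.

(** * Entries of the transition matrices *)

(** The sum of the absolute values of all entries is a submultiplicative norm that
    dominates each entry. *)
Lemma matrix_expr_entry_bound (R : numDomainType) (n : nat) (A : 'M[R]_n.+1)
    (i j : 'I_n.+1) (k : nat) :
  `|(A ^+ k) i j| <= (\sum_a \sum_b `|A a b|) ^+ k.
Proof.
set c := \sum_a _.
have c0 : 0 <= c by do 2! (apply: sumr_ge0 => ? _).
elim: k i => [|k IH] i.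
  by rewrite !expr0 mxE; case: eqP => _; rewrite ?normr1 ?normr0.
rewrite !exprS mxE (le_trans (ler_norm_sum _ _ _)) //.
apply: (@le_trans _ _ (\sum_b `|A i b| * c ^+ k)).
  by apply: ler_sum => b _; rewrite normrM ler_wpM2l.
rewrite -mulr_suml.
rewrite ler_wpM2r ?exprn_ge0 // /c [leRHS](bigD1 i) //= lerDl.
by do 2! (apply: sumr_ge0 => ? _).
Qed.

Lemma is_cvg_exp_dominated (R : realType) (a : R ^nat) (m c : R) :
  0 <= m -> 0 <= c -> (forall k, `|a k| <= m * c ^+ k) ->
  forall x, cvgn (pseries (fun k => k`!%:R^-1 * a k) x).
Proof.
move=> m0 c0 aP x; apply: normed_cvg.
apply: (@series_le_cvg _ _ (m \*o exp_coeff (c * `|x|))).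
- by move=> k /=.
- by move=> k /=; rewrite mulr_ge0 // exp_coeff_ge0 // mulr_ge0.
- move=> k /=; rewrite /exp_coeff /= !normrM normfV normr_nat exprMn normrX.
  rewrite -[in leLHS]mulrA mulrC !mulrA ler_wpM2r ?invr_ge0 ?ler0n //.
  by rewrite ler_wpM2r ?exprn_ge0.
- by apply: is_cvg_seriesZ; exact: is_cvg_series_exp_coeff.
Qed.

(** Differentiating the series term by term shifts the sequence [a], and a shifted
    sequence is dominated in the same way; this is why the factorials are kept
    apart from [a]. *)
Lemma is_derive_exp_dominated (R : realType) (a : R ^nat) (m c : R) :
  0 <= m -> 0 <= c -> (forall k, `|a k| <= m * c ^+ k) ->
  is_derive (0 : R) (1 : R) (fun x => limn (pseries (fun k => k`!%:R^-1 * a k) x)) (a 1%N).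
Proof.
move=> m0 c0 aP.
have diffsE (b : R ^nat) : pseries_diffs (fun k => k`!%:R^-1 * b k) =
    (fun k => k`!%:R^-1 * b k.+1).
  by apply/funext => k; rewrite /pseries_diffs mulrA factS natrM invfM mulVKf.
have domS (b : R ^nat) q : (forall k, `|b k| <= q * c ^+ k) ->
    forall k, `|b k.+1| <= (q * c) * c ^+ k.
  by move=> bP k; rewrite -mulrA -exprS.
have a1P := domS _ _ aP; have a2P := domS _ _ a1P.
have -> : a 1%N = limn (pseries (pseries_diffs (fun k => k`!%:R^-1 * a k)) 0).
  rewrite diffsE; apply/esym/lim_near_cst => //.
  exists 1%N => // -[|k] //= _.
  rewrite /pseries /series /= big_nat_recl //= big1_seq ?addr0; last first.
    by move=> i _; rewrite expr0n mulr0.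
  by rewrite expr0 fact0 invr1 mul1r mulr1.
apply: (@pseries_snd_diffs _ _ 1); rewrite ?diffsE ?normr0 ?normr1 ?ltr01 //.
- exact: (is_cvg_exp_dominated m0 c0 aP).
- exact: (is_cvg_exp_dominated (mulr_ge0 m0 c0) c0 a1P).
- exact: (is_cvg_exp_dominated (mulr_ge0 (mulr_ge0 m0 c0) c0) c0 a2P).
Qed.

(** This lets the matrix exponential be computed entry by entry, as real power
    series. *)
Lemma cvg_mx_entrywise (R : realType) (m n : nat) (u : nat -> 'M[R]_(m, n))
    (M : 'M[R]_(m, n)) :
  (forall i j, u k i j @[k --> \oo] --> M i j) -> u k @[k --> \oo] --> M.
Proof.
move=> uM; apply/cvg_mx_entourageP => E entE.
suff : \forall k \near \oo, forall i j, (M i j, u k i j) \in E by [].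
apply: filter_forall => i.
apply: filter_forall => j.
have /cvg_entourageP/(_ E entE) := uM i j.
by move=> near_uM; near=> k; rewrite inE; near: k; exact: near_uM.
Unshelve. all: by end_near. Qed.

Lemma is_cvg_transition_entry (R : realType) (Q : 'M[R]_3) (t : R) (i j : 'I_3) :
  cvgn (pseries (fun k => k`!%:R^-1 * (Q ^+ k) i j) t).
Proof.
apply: (@is_cvg_exp_dominated _ (fun k => (Q ^+ k) i j) 1 (\sum_a \sum_b `|Q a b|)) => //.
- by do 2! (apply: sumr_ge0 => ? _).
- by move=> k; rewrite mul1r matrix_expr_entry_bound.
Qed.

Lemma transitionE (R : realType) (Q : 'M[R]_3) (t : R) (i j : 'I_3) :
  transition Q t i j = limn (pseries (fun k => k`!%:R^-1 * (Q ^+ k) i j) t).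
Proof.
pose M : 'M[R]_3 := \matrix_(i, j) limn (pseries (fun k => k`!%:R^-1 * (Q ^+ k) i j) t).
suff -> : transition Q t = M by rewrite mxE.
apply: cvg_lim; first exact: norm_hausdorff.
apply: cvg_mx_entrywise => a b; rewrite mxE.
apply: cvg_trans (@is_cvg_transition_entry R Q t a b).
apply: near_eq_cvg; near=> n.
rewrite /pseries /series /= summxE; apply: eq_bigr => k _.
by rewrite mxE exprZn mxE -mulrA [_ * t ^+ k]mulrC.
Unshelve. all: by end_near. Qed.

Lemma cvg_transition_entry (R : realType) (Q : 'M[R]_3) (t : R) (i j : 'I_3) :
  pseries (fun k => k`!%:R^-1 * (Q ^+ k) i j) t n @[n --> \oo] --> transition Q t i j.
Proof. by rewrite transitionE; exact: is_cvg_transition_entry. Qed.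

Lemma is_derive_transition (R : realType) (Q : 'M[R]_3) (i j : 'I_3) :
  is_derive (0 : R) (1 : R) (fun t => transition Q t i j) (Q i j).
Proof.
rewrite (_ : (fun t => _) =
    fun t => limn (pseries (fun k => k`!%:R^-1 * (Q ^+ k) i j) t)); last first.
  by apply/funext => t; exact: transitionE.
rewrite -[X in is_derive _ _ _ (X i j)]expr1.
apply: (@is_derive_exp_dominated _ (fun k => (Q ^+ k) i j) 1 (\sum_a \sum_b `|Q a b|)) => //.
- by do 2! (apply: sumr_ge0 => ? _).
- by move=> k; rewrite mul1r matrix_expr_entry_bound.
Qed.

Lemma transition0 (R : realType) (Q : 'M[R]_3) : transition Q 0 = 1%:M.
Proof.
apply/matrixP => i j; rewrite transitionE; apply: lim_near_cst => //.
exists 1%N => // -[|k] //= _.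
rewrite /pseries /series /= big_nat_recl //= big1_seq ?addr0; last first.
  by move=> l _; rewrite expr0n mulr0.
by rewrite !expr0 fact0 invr1 mul1r mulr1.
Qed.

Lemma transition_cvg0 (R : realType) (Q : 'M[R]_3) (i j : 'I_3) :
  transition Q t i j @[t --> 0^'+] --> ((i == j)%:R : R).
Proof.
have -> : (i == j)%:R = transition Q 0 i j by rewrite transition0 mxE.
apply: cvg_at_right_filter.
have [dv _] := @is_derive_transition R Q i j.
by have /derivable1_diffP/differentiable_continuous := dv; exact.
Qed.

(** All powers of [Q] but the zeroth have zero row sums. *)
Lemma transition_sum1 (R : realType) (Q : 'M[R]_3) (t : R) :
  (forall i, \sum_j Q i j = 0) ->
  transition Q t *m const_mx 1 = const_mx 1 :> 'cV_3.
Proof.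
move=> Q0.
have Qk k i : \sum_j (Q ^+ k.+1) i j = 0.
  rewrite exprSr; under eq_bigr do rewrite mxE.
  by rewrite exchange_big /= big1 // => l _; rewrite -mulr_sumr Q0 mulr0.
apply/colP => i; rewrite !mxE.
under eq_bigr do rewrite mxE mulr1.
have : \sum_j pseries (fun k => k`!%:R^-1 * (Q ^+ k) i j) t n @[n --> \oo] -->
    \sum_j transition Q t i j.
  by apply: cvg_big => [|j _]; [exact: add_continuous|exact: cvg_transition_entry].
move/(cvg_lim _) => <- //; apply: lim_near_cst => //.
exists 1%N => // -[|n] //= _.
rewrite /pseries /series /= exchange_big /= big_nat_recl //= [X in _ + X]big1_seq ?addr0.
  rewrite fact0 !expr0 (bigD1 i) //= big1 ?addr0; first by rewrite mxE eqxx invr1 !mulr1.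
  by move=> j /negPf ji; rewrite mxE eq_sym ji mulr0 mul0r.
move=> k _; rewrite -mulr_suml -mulr_sumr Qk.
by rewrite mulr0 mul0r.
Qed.

(** Detailed balance passes to the powers of [Q], hence to the series. *)
Lemma transition_detailed_balance (R : realType) (Q : 'M[R]_3) (mu : 'rV[R]_3)
    (t : R) (i j : 'I_3) :
  underlying_reversible Q mu ->
  mu 0 i * transition Q t i j = mu 0 j * transition Q t j i.
Proof.
move=> rev.
have Qk k a b : mu 0 a * (Q ^+ k) a b = mu 0 b * (Q ^+ k) b a.
  elim: k a b => [|k IH] a b.
    by rewrite !mxE eq_sym; case: eqP => [->|]; rewrite ?mulr0.
  rewrite [in LHS]exprS [in RHS]exprSr !mxE !mulr_sumr; apply: eq_bigr => l _.
  by rewrite mulrA rev mulrAC IH -mulrA.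
have lim_scaled a b : mu 0 a * transition Q t a b =
    limn (fun n => mu 0 a * pseries (fun k => k`!%:R^-1 * (Q ^+ k) a b) t n).
  apply/esym/cvg_lim => //; apply: cvgM; first exact: cvg_cst.
  exact: cvg_transition_entry.
rewrite !lim_scaled.
congr (limn _); apply/funext => n.
rewrite /pseries /series /= !mulr_sumr; apply: eq_bigr => k _.
by rewrite !mulrA ![mu 0 _ * _]mulrC -!(mulrA k`!%:R^-1) Qk.
Qed.

(** The converse of [transition_detailed_balance]: the rates are the right
    derivatives of the transition probabilities at [0]. *)
Lemma rates_detailed_balance (R : realType) (Q : 'M[R]_3) (mu : 'rV[R]_3)
    (i j : 'I_3) :
  (forall t, 0 < t -> mu 0 i * transition Q t i j = mu 0 j * transition Q t j i) ->
  mu 0 i * Q i j = mu 0 j * Q j i.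
Proof.
move=> bal.
have quotient a b : mu 0 a * (t^-1 * (transition Q t a b - transition Q 0 a b))
    @[t --> 0^'+] --> mu 0 a * Q a b.
  apply: cvgM; [exact: cvg_cst|apply: cvg_dnbhs_at_right].
  have [dv dE] := @is_derive_transition R Q a b.
  rewrite -dE; apply: cvg_trans dv.
  apply: near_eq_cvg; near=> h => /=.
  by rewrite /GRing.scale /= mulr1 addr0.
apply: (cvg_unique (@Rhausdorff R) (quotient i j)); apply: cvg_trans (quotient j i).
apply: near_eq_cvg; near=> t.
have t0 : 0 < t by near: t; exact: nbhs_right_gt.
rewrite /= transition0 !mxE ![mu 0 _ * (_^-1 * _)]mulrCA ![mu 0 _ * (_ - _)]mulrBr.
by rewrite bal // eq_sym; case: eqP => [->|_]; rewrite ?mulr0.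
Unshelve. all: by end_near. Qed.

(** * Summation over finite-valued random variables *)

Lemma prob_fiber_sum (R : realType) (d : measure_display) (T : measurableType d)
    (P : probability T R) (I : finType) (X : T -> I) (A : set T) :
  measurable A -> (forall i, measurable (X @^-1` [set i])) ->
  fine (P A) = \sum_i fine (P (A `&` X @^-1` [set i])).
Proof.
move=> mA mX; apply: EFin_inj; rewrite -sumEFin.
have mAX i : measurable (A `&` X @^-1` [set i]) by exact: measurableI.
under eq_bigr do rewrite fineK ?fin_num_measure //.
rewrite fineK ?fin_num_measure //.
have {1}-> : A = \bigcup_(i in [set: I]) (A `&` X @^-1` [set i]).
  by apply/seteqP; split => [w Aw|w [i _ []]//]; exists (X w).
rewrite measure_fin_bigcup //; first last.
- by move=> i j _ _ [w [[_ <-] [_ <-]]].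
- exact: finite_finset.
rewrite (@fsbigE _ _ _ _ _ (enum I)) ?enum_uniq //; last first.
  by move=> i _; rewrite mem_enum.
by rewrite big_enum_cond /=; apply: eq_bigl => i; rewrite in_setT.
Qed.

Lemma measurable_path_event (R : realType) (d : measure_display)
    (T : measurableType d) (E : Type) (X : R -> T -> E) (n : nat)
    (t : 'I_n -> R) (x : 'I_n -> E) :
  (forall k, measurable (X (t k) @^-1` [set x k])) ->
  measurable (path_event X t x).
Proof.
move=> mX; rewrite (_ : path_event X t x =
  \bigcap_(k in [set: 'I_n]) (X (t k) @^-1` [set x k])); last first.
  by apply/seteqP; split => w Xw k; [move=> _; exact: Xw|exact: Xw k I].
exact: fin_bigcap_measurable.
Qed.

Lemma prob_path_sum (R : realType) (d : measure_display) (T : measurableType d)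
    (P : probability T R) (I : finType) (X : R -> T -> I) (n : nat)
    (t : 'I_n -> R) (A : set T) :
  (forall k i, measurable (X (t k) @^-1` [set i])) -> measurable A ->
  fine (P A) = \sum_(x : {ffun 'I_n -> I}) fine (P (path_event X t x `&` A)).
Proof.
move=> mX mA.
pose Y w := [ffun k => X (t k) w].
have fibE x : Y @^-1` [set x] = path_event X t x.
  apply/seteqP; split => w /=; first by move=> <- k; rewrite ffunE.
  by move=> Xw; apply/ffunP => k; rewrite ffunE; exact: Xw.
rewrite (@prob_fiber_sum _ _ _ _ _ Y) //; last first.
  by move=> x; rewrite fibE; exact: measurable_path_event.
by apply: eq_bigr => x _; rewrite fibE setIC.
Qed.

(** Turns the equations between extended reals that define the model into equations
    between reals, where sums can be handled freely. *)
Lemma fine_probM (R : realType) (d : measure_display) (T : measurableType d)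
    (P : probability T R) (A B : set T) (r : R) :
  measurable B -> P A = (P B * r%:E)%E -> fine (P A) = fine (P B) * r.
Proof.
by move=> mB PAB; rewrite PAB -[in LHS](fineK (fin_num_measure P _ mB)).
Qed.

(** * Events given by finite lists of observations *)

Definition history {R : realType} {T : Type} {E : eqType} (S : R -> T -> E)
    (l : seq (R * E)) : set T :=
  [set w | forall x, x \in l -> S x.1 w = x.2].

Lemma history_nil (R : realType) (T : Type) (E : eqType) (S : R -> T -> E) :
  history S [::] = setT.
Proof. by apply/seteqP; split. Qed.

Lemma history_cons (R : realType) (T : Type) (E : eqType) (S : R -> T -> E)
    (x : R * E) (l : seq (R * E)) :
  history S (x :: l) = history S l `&` S x.1 @^-1` [set x.2].
Proof.
apply/seteqP; split => w.
  by move=> h; split => [y yl|]; apply: h; rewrite inE ?yl ?orbT ?eqxx.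
by case=> h hx y; rewrite inE => /predU1P[->//|]; exact: h.
Qed.

Lemma history_eqi (R : realType) (T : Type) (E : eqType) (S : R -> T -> E)
    (l l' : seq (R * E)) : l =i l' -> history S l = history S l'.
Proof.
by move=> ll; apply/seteqP; split => w h x; [rewrite -ll|rewrite ll]; exact: h.
Qed.

(** Lists of dated observations, unlike families indexed by ordinals, can be
    extended, reversed and freed of repetitions. *)
Lemma path_event_history (R : realType) (T : Type) (E : eqType) (S : R -> T -> E)
    (n : nat) (t : 'I_n -> R) (s : 'I_n -> E) :
  path_event S t s = history S [seq (t k, s k) | k <- enum 'I_n].
Proof.
apply/seteqP; split => w h.
  by move=> x /mapP[k _ ->]; exact: h.
by move=> k; apply: (h (t k, s k)); apply: map_f; rewrite mem_enum.
Qed.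

Lemma history_path_event (R : realType) (T : Type) (E : eqType) (S : R -> T -> E)
    (l : seq (R * E)) :
  history S l = path_event S (fun k => (tnth (in_tuple l) k).1)
                             (fun k => (tnth (in_tuple l) k).2).
Proof.
rewrite path_event_history; congr history.
rewrite -[LHS]/(tval (in_tuple l)) -[in LHS](map_tnth_enum (in_tuple l)).
by apply: eq_map => k; rewrite -surjective_pairing.
Qed.

Lemma history_nonneg_before (R : realType) (E : eqType) (l : seq (R * E)) (u : R) :
  path >%R u (unzip1 l) -> all (>= 0) (unzip1 l) ->
  forall k, 0 <= (tnth (in_tuple l) k).1 < u.
Proof.
move=> lu l0 k.
have kl : (tnth (in_tuple l) k).1 \in unzip1 l by apply: map_f; exact: mem_tnth.
rewrite (allP l0 _ kl) /=.
move: lu; rewrite path_sortedE; last by move=> a b c ba ac; exact: lt_trans ac ba.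
by case/andP=> /allP/(_ _ kl).
Qed.

Lemma measurable_history (R : realType) (d : measure_display)
    (T : measurableType d) (E : eqType) (S : R -> T -> E) (l : seq (R * E)) :
  (forall t s, 0 <= t -> measurable (S t @^-1` [set s])) ->
  all (>= 0) (unzip1 l) -> measurable (history S l).
Proof.
move=> mS; elim: l => [|x l IH] /=; first by rewrite history_nil.
by case/andP=> x0 l0; rewrite history_cons; apply: measurableI; [exact: IH|exact: mS].
Qed.

(** * Finite-dimensional laws of a hidden Markov model *)

(** The Markov and emission properties concern histories that record the hidden
    states as well; the hidden states of the past are summed out. *)
Lemma hmm_past_observed (R : realType) (d : measure_display) (T : measurableType d)
    (P : probability T R) (K : nat) (Q : 'M[R]_3) (mu : 'rV[R]_3)
    (Pi : 'M[R]_(3, K)) (C : R -> T -> 'I_3) (S : R -> T -> 'I_K)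
    (hCS : hidden_markov_model P Q mu Pi C S) (l : seq (R * 'I_K)) (u v : R)
    (i j : 'I_3) (k : 'I_K) :
  path >%R u (unzip1 l) -> all (>= 0) (unzip1 l) -> 0 <= u < v ->
  fine (P (history S ((u, k) :: l) `&` C u @^-1` [set i] `&` C v @^-1` [set j])) =
  fine (P (history S l `&` C u @^-1` [set i])) * Pi i k * transition Q (v - u) i j.
Proof.
move=> lu l0 /andP[u0 uv].
have mC t' a : 0 <= t' -> measurable (C t' @^-1` [set a]) by exact: (hmm_measurable_hidden hCS).
have mS t' a : 0 <= t' -> measurable (S t' @^-1` [set a]) by exact: (hmm_measurable_observed hCS).
have v0 : 0 <= v by rewrite (le_trans u0) // ltW.
have ml := measurable_history mS l0.
pose t q := (tnth (in_tuple l) q).1; pose s q := (tnth (in_tuple l) q).2.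
have tu q : 0 <= t q < u by exact: history_nonneg_before.
have mCt q a : measurable (C (t q) @^-1` [set a]) by case/andP: (tu q) => + _; exact: mC.
have mSt q a : measurable (S (t q) @^-1` [set a]) by case/andP: (tu q) => + _; exact: mS.
rewrite history_cons /= !(history_path_event S l) -/t -/s.
have mpS : measurable (path_event S t s) by exact: measurable_path_event.
have mpC c : measurable (path_event C t c) by exact: measurable_path_event.
rewrite (@prob_path_sum _ _ _ P _ C _ t) //; last first.
  by repeat apply: measurableI; auto.
rewrite [in RHS](@prob_path_sum _ _ _ P _ C _ t) //; last first.
  by apply: measurableI; auto.
rewrite -mulrA mulr_suml; apply: eq_bigr => c _.
pose past := path_event C t c `&` path_event S t s.
have mpast : measurable past by exact: measurableI.
transitivity (fine (P (past `&` (C u @^-1` [set i] `&` S u @^-1` [set k])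
    `&` C v @^-1` [set j]))).
  by congr (fine (P _)); apply/seteqP; split => w /=; rewrite /past /=; tauto.
have := @hmm_markov _ _ _ _ _ _ _ _ _ _ hCS _ t c s u v i j k tu.
rewrite u0 uv => /(_ isT) /fine_probM ->; last by repeat apply: measurableI; auto.
rewrite mulrA; congr (_ * _).
transitivity (fine (P (past `&` C u @^-1` [set i] `&` S u @^-1` [set k]))).
  by congr (fine (P _)); apply/seteqP; split => w /=; rewrite /past /=; tauto.
have := @hmm_emission _ _ _ _ _ _ _ _ _ _ hCS _ t c s u i k tu u0.
move=> /fine_probM ->; last by repeat apply: measurableI; auto.
by congr (fine (P _) * _); apply/seteqP; split => w /=; rewrite /past /=; tauto.
Qed.

(** The Markov property of the hidden process with respect to its own past: the
    observations, past and present, are summed out. *)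
Lemma hmm_past_hidden (R : realType) (d : measure_display) (T : measurableType d)
    (P : probability T R) (K : nat) (Q : 'M[R]_3) (mu : 'rV[R]_3)
    (Pi : 'M[R]_(3, K)) (C : R -> T -> 'I_3) (S : R -> T -> 'I_K)
    (hCS : hidden_markov_model P Q mu Pi C S) (n : nat) (t : 'I_n -> R)
    (c : 'I_n -> 'I_3) (u v : R) (i j : 'I_3) :
  (forall q, 0 <= t q < u) -> 0 <= u < v ->
  fine (P (path_event C t c `&` C u @^-1` [set i] `&` C v @^-1` [set j])) =
  fine (P (path_event C t c `&` C u @^-1` [set i])) * transition Q (v - u) i j.
Proof.
move=> tu /andP[u0 uv].
have mC t' a : 0 <= t' -> measurable (C t' @^-1` [set a]) by exact: (hmm_measurable_hidden hCS).
have mS t' a : 0 <= t' -> measurable (S t' @^-1` [set a]) by exact: (hmm_measurable_observed hCS).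
have v0 : 0 <= v by rewrite (le_trans u0) // ltW.
have mCt q a : measurable (C (t q) @^-1` [set a]) by case/andP: (tu q) => + _; exact: mC.
have mSt q a : measurable (S (t q) @^-1` [set a]) by case/andP: (tu q) => + _; exact: mS.
have mpS s : measurable (path_event S t s) by exact: measurable_path_event.
have mpC : measurable (path_event C t c) by exact: measurable_path_event.
have sum_obs A : measurable A -> fine (P A) =
    \sum_(k : 'I_K) \sum_(s : {ffun 'I_n -> 'I_K})
      fine (P (path_event S t s `&` (A `&` S u @^-1` [set k]))).
  move=> mA; rewrite (@prob_fiber_sum _ _ _ P _ (S u)) //; last by move=> k; exact: mS.
  apply: eq_bigr => k _; apply: prob_path_sum => //.
  by apply: measurableI => //; exact: mS.
rewrite sum_obs; last by repeat apply: measurableI; auto.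
rewrite [in RHS]sum_obs; last by repeat apply: measurableI; auto.
rewrite mulr_suml; apply: eq_bigr => k _; rewrite mulr_suml; apply: eq_bigr => s _.
have := @hmm_markov _ _ _ _ _ _ _ _ _ _ hCS _ t c s u v i j k tu.
rewrite u0 uv => /(_ isT) /fine_probM markov.
transitivity (fine (P (path_event C t c `&` path_event S t s `&`
  (C u @^-1` [set i] `&` S u @^-1` [set k]) `&` C v @^-1` [set j]))).
  by congr (fine (P _)); apply/seteqP; split => w /=; tauto.
rewrite markov; last by repeat apply: measurableI; auto.
congr (_ * _); congr (fine (P _)); apply/seteqP; split => w /=; tauto.
Qed.

(** Only the law at time [0] is part of the model; the law at a later time is
    transported by the kernel, which preserves [mu]. *)
Lemma hmm_stationary_law (R : realType) (d : measure_display) (T : measurableType d)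
    (P : probability T R) (K : nat) (Q : 'M[R]_3) (mu : 'rV[R]_3)
    (Pi : 'M[R]_(3, K)) (C : R -> T -> 'I_3) (S : R -> T -> 'I_K)
    (hCS : hidden_markov_model P Q mu Pi C S) (t : R) (j : 'I_3) :
  0 <= t -> fine (P (C t @^-1` [set j])) = mu 0 j.
Proof.
have mC t' a : 0 <= t' -> measurable (C t' @^-1` [set a]) by exact: (hmm_measurable_hidden hCS).
rewrite le_eqVlt => /predU1P[<-|t0]; first by rewrite (hmm_initial hCS).
rewrite (@prob_fiber_sum _ _ _ P _ (C 0)); last 2 first.
- by apply: mC; exact: ltW.
- by move=> i; exact: mC.
rewrite -[in RHS](hmm_stationary hCS (ltW t0)) mxE; apply: eq_bigr => i _.
have := @hmm_past_hidden _ _ _ _ _ _ _ _ _ _ hCS 0 (fun=> 0) (fun=> i) 0 t i j.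
rewrite lexx t0 subr0 => /(_ _ isT) markov.
have setT0 : path_event C (fun=> 0) (fun _ : 'I_0 => i) = setT.
  by apply/seteqP; split => // w _ [].
rewrite setIC -(setTI (C 0 @^-1` _)) -setT0 markov; last by case.
by rewrite setT0 setTI (hmm_initial hCS).
Qed.

(** The Chapman-Kolmogorov equation, read off the law of the hidden process at the
    times [0], [s], [s + t] when it starts at [i], an event of positive
    probability. *)
Lemma transition_semigroup (R : realType) (d : measure_display) (T : measurableType d)
    (P : probability T R) (K : nat) (Q : 'M[R]_3) (mu : 'rV[R]_3)
    (Pi : 'M[R]_(3, K)) (C : R -> T -> 'I_3) (S : R -> T -> 'I_K)
    (hCS : hidden_markov_model P Q mu Pi C S) (s t : R) :
  0 < s -> 0 < t -> transition Q s *m transition Q t = transition Q (s + t).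
Proof.
move=> s0 t0; have st0 := addr_gt0 s0 t0.
have mC t' a : 0 <= t' -> measurable (C t' @^-1` [set a]) by exact: (hmm_measurable_hidden hCS).
apply/matrixP => i k; rewrite mxE.
have mui : mu 0 i != 0 by rewrite gt_eqF //; case: (hmm_positive hCS).
have jump v (j : 'I_3) : 0 < v ->
    fine (P (C 0 @^-1` [set i] `&` C v @^-1` [set j])) = mu 0 i * transition Q v i j.
  move=> v0.
  have := @hmm_past_hidden _ _ _ _ _ _ _ _ _ _ hCS 0 (fun=> 0) (fun=> i) 0 v i j.
  rewrite lexx v0 subr0 => /(_ _ isT).
  rewrite (_ : path_event _ _ _ = setT); last by apply/seteqP; split => // w _ [].
  by rewrite !setTI (hmm_initial hCS); apply; case.
apply: (mulfI mui); rewrite -jump //.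
rewrite (@prob_fiber_sum _ _ _ P _ (C s)); last 2 first.
- by apply: measurableI; apply: mC => //; exact: ltW.
- by move=> j; apply: mC; exact: ltW.
rewrite mulr_sumr; apply: eq_bigr => j _; rewrite mulrA -jump //.
have := @hmm_past_hidden _ _ _ _ _ _ _ _ _ _ hCS 1 (fun=> 0) (fun=> i) s (s + t) j k.
have -> : path_event C (fun=> 0) (fun _ : 'I_1 => i) = C 0 @^-1` [set i].
  by apply/seteqP; split => w h; [exact: (h ord0)|move=> q].
rewrite lexx s0 ltW // ltrDl t0 (addrC s) addrK => /(_ (fun=> isT) isT) <-.
by congr (fine (P _)); apply/seteqP; split => w /=; tauto.
Qed.

Definition emission_mx {R : realType} {K : nat} (Pi : 'M[R]_(3, K)) (k : 'I_K) :
  'M[R]_3 := diag_mx (\row_i Pi i k).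

Lemma hmm_filter (R : realType) (d : measure_display) (T : measurableType d)
    (P : probability T R) (K : nat) (Q : 'M[R]_3) (mu : 'rV[R]_3)
    (Pi : 'M[R]_(3, K)) (C : R -> T -> 'I_3) (S : R -> T -> 'I_K)
    (hCS : hidden_markov_model P Q mu Pi C S) (l : seq (R * 'I_K)) (t : R)
    (j : 'I_3) :
  path >%R t (unzip1 l) -> all (>= 0) (unzip1 l) -> 0 <= t ->
  fine (P (history S l `&` C t @^-1` [set j])) =
  filter_before mu (emission_mx Pi) (transition Q) t l 0 j.
Proof.
have mC t' a : 0 <= t' -> measurable (C t' @^-1` [set a]) by exact: (hmm_measurable_hidden hCS).
have mS t' a : 0 <= t' -> measurable (S t' @^-1` [set a]) by exact: (hmm_measurable_observed hCS).
elim: l t j => [|[u k] l IH] t j /=.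
  by move=> _ _ t0; rewrite history_nil setTI (hmm_stationary_law hCS).
case/andP=> ut lu /andP[u0 l0] t0.
have ml : measurable (history S ((u, k) :: l)).
  by apply: measurable_history => //=; rewrite u0.
rewrite (@prob_fiber_sum _ _ _ P _ (C u)); last 2 first.
- by apply: measurableI; auto.
- by move=> i; exact: mC.
rewrite [RHS]mxE; apply: eq_bigr => i _.
rewrite setIAC (hmm_past_observed hCS) ?u0 // IH //.
by rewrite mul_mx_diag !mxE.
Qed.

(** The product formula for the law of the observations at distinct times. *)
Lemma hmm_history_prob (R : realType) (d : measure_display) (T : measurableType d)
    (P : probability T R) (K : nat) (Q : 'M[R]_3) (mu : 'rV[R]_3)
    (Pi : 'M[R]_(3, K)) (C : R -> T -> 'I_3) (S : R -> T -> 'I_K)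
    (hCS : hidden_markov_model P Q mu Pi C S) (l : seq (R * 'I_K)) (t : R) :
  path >%R t (unzip1 l) -> all (>= 0) (unzip1 l) -> 0 <= t ->
  P (history S l) = ((filter_before mu (emission_mx Pi) (transition Q) t l
     *m const_mx 1 : 'M[R]_1) 0 0)%:E.
Proof.
move=> lt l0 t0.
have ml : measurable (history S l).
  by apply: measurable_history => //; exact: (hmm_measurable_observed hCS).
rewrite -[LHS]fineK ?fin_num_measure //; congr EFin.
rewrite (@prob_fiber_sum _ _ _ P _ (C t)) //; last first.
  by move=> j; exact: (hmm_measurable_hidden hCS).
rewrite mxE; apply: eq_bigr => j _.
by rewrite (hmm_filter hCS) // [const_mx _ _ _]mxE mulr1.
Qed.

(** * The dual semigroup *)

(** The transition matrices of the hidden process run backwards in time. *)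
Definition dual_kernel {R : fieldType} {n : nat} (mu : 'rV[R]_n)
    (p : R -> 'M[R]_n) (t : R) : 'M[R]_n :=
  \matrix_(i, j) (mu 0 j * p t j i / mu 0 i).

Lemma tr_dual_kernel (R : fieldType) (n : nat) (mu : 'rV[R]_n)
    (p : R -> 'M[R]_n) (t : R) :
  (forall i, mu 0 i != 0) ->
  (dual_kernel mu p t)^T *m diag_mx mu = diag_mx mu *m p t.
Proof.
move=> mu0; apply/matrixP => i j.
by rewrite mul_mx_diag mul_diag_mx !mxE mulfVK.
Qed.

(** Duality exchanges stationarity of [mu] with conservation of mass; this lemma and
    [dual_kernel_sum1] are the two halves. *)
Lemma dual_kernel_stationary (R : fieldType) (n : nat) (mu : 'rV[R]_n)
    (p : R -> 'M[R]_n) (t : R) :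
  (forall i, mu 0 i != 0) -> p t *m const_mx 1 = const_mx 1 :> 'cV_n ->
  mu *m dual_kernel mu p t = mu.
Proof.
move=> mu0 p1; apply/rowP => j; rewrite mxE.
under eq_bigr do rewrite mxE mulrC mulfVK //.
have /colP/(_ j) := p1; rewrite !mxE => p1j.
rewrite -mulr_sumr -[RHS]mulr1 -[in RHS]p1j; congr (_ * _).
by apply: eq_bigr => i _; rewrite mxE mulr1.
Qed.

Lemma dual_kernel_sum1 (R : fieldType) (n : nat) (mu : 'rV[R]_n)
    (p : R -> 'M[R]_n) (t : R) :
  (forall i, mu 0 i != 0) -> mu *m p t = mu ->
  dual_kernel mu p t *m const_mx 1 = const_mx 1 :> 'cV_n.
Proof.
move=> mu0 mup; apply/colP => i; rewrite !mxE.
under eq_bigr do rewrite !mxE mulr1.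
rewrite -mulr_suml; have /rowP/(_ i) := mup; rewrite mxE => ->.
by rewrite divff.
Qed.

Lemma dual_kernel_semigroup (R : fieldType) (n : nat) (mu : 'rV[R]_n)
    (p : R -> 'M[R]_n) (s t : R) :
  (forall i, mu 0 i != 0) -> p t *m p s = p (t + s) ->
  dual_kernel mu p s *m dual_kernel mu p t = dual_kernel mu p (s + t).
Proof.
move=> mu0 pD; apply/matrixP => i j; rewrite !mxE addrC -pD mxE.
rewrite mulr_sumr mulr_suml; apply: eq_bigr => k _; rewrite !mxE.
by field; rewrite !mu0.
Qed.

(** * Sufficient conditions for reversibility *)

(** Provides a time at which a filter can be stopped, later than all the
    observations. *)
Lemma exists_newest_bound (R : realFieldType) (s : seq R) :
  sorted >%R s -> all (>= 0) s -> exists2 t, 0 <= t & path >%R t s.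
Proof.
case: s => [|x s] /=; first by exists 0.
move=> xs /andP[x0 _]; exists (x + 1); first by rewrite addr_ge0.
by rewrite xs ltrDl ltr01.
Qed.

(** Reversal changes the filter into the dual one, which by hypothesis has the same
    mass. *)
Lemma history_reversal (R : realType) (d : measure_display) (T : measurableType d)
    (P : probability T R) (K : nat) (Q : 'M[R]_3) (mu : 'rV[R]_3)
    (Pi : 'M[R]_(3, K)) (C : R -> T -> 'I_3) (S : R -> T -> 'I_K)
    (hCS : hidden_markov_model P Q mu Pi C S) (a : R) (l : seq (R * 'I_K)) :
  (forall t, path >%R t (unzip1 l) ->
     filter_before mu (emission_mx Pi) (dual_kernel mu (transition Q)) t l *m const_mx 1 =
     filter_before mu (emission_mx Pi) (transition Q) t l *m const_mx 1 :> 'M[R]_1) ->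
  sorted >%R (unzip1 l) -> all (>= 0) (unzip1 l) ->
  all (>= 0) [seq a - x.1 | x <- l] ->
  P (history S l) = P (history S [seq (a - x.1, x.2) | x <- l]).
Proof.
move=> dualE sl l0 al0.
have mu0 i : mu 0 i != 0 by rewrite gt_eqF //; case: (hmm_positive hCS).
have [t t0 lt] := exists_newest_bound sl l0.
pose l' := rev [seq (a - x.1, x.2) | x <- l].
have ul' : unzip1 l' = rev [seq a - x.1 | x <- l].
  by rewrite /unzip1 map_rev -map_comp.
have l'0 : all (>= 0) (unzip1 l') by rewrite ul' all_rev.
have sl' : sorted >%R (unzip1 l').
  rewrite ul' rev_sorted (map_comp (fun x => a - x)) sorted_map.
  by apply: sub_sorted sl => x y /=; rewrite ltrD2l ltrN2.
have [u u0 lu] := exists_newest_bound sl' l'0.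
have -> : history S [seq (a - x.1, x.2) | x <- l] = history S l'.
  by apply: history_eqi => x; rewrite mem_rev.
rewrite (hmm_history_prob hCS lt) // (hmm_history_prob hCS lu) // -dualE //.
congr EFin; congr (fun_of_matrix _ 0 0).
apply: (@filter_time_reversal _ _ _ _ (fun k => \row_i Pi i k)) => //.
- by move=> s _; exact: tr_dual_kernel.
- by move=> s; apply: transition_sum1; case: (hmm_rates hCS).
- exact: (hmm_stationary hCS).
Qed.

Lemma history_conflict (R : realType) (T : Type) (E : eqType) (S : R -> T -> E)
    (l : seq (R * E)) (x y : R * E) :
  x \in l -> y \in l -> x.1 = y.1 -> x.2 != y.2 -> history S l = set0.
Proof.
move=> xl yl xy1 xy2; apply/seteqP; split => // w h /=.
by move/eqP: xy2; apply; rewrite -(h x xl) -(h y yl) xy1.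
Qed.

Lemma sorted_time_events (R : realType) (E : eqType) (n : nat) (t : 'I_n -> R)
    (s : 'I_n -> E) :
  (forall k l : 'I_n, (k <= l)%N -> t k <= t l) ->
  let l := undup [seq (t k, s k) | k <- enum 'I_n] in
  {in l &, injective fst} -> sorted >%R (unzip1 (rev l)).
Proof.
move=> tmono l linj.
rewrite /unzip1 map_rev rev_sorted.
rewrite -[sorted _ _]/(sorted <%R _) lt_sorted_uniq_le.
rewrite map_inj_in_uniq // undup_uniq /= sorted_map.
apply: (subseq_sorted _ (undup_subseq _)); first by move=> x y z /=; exact: le_trans.
apply: (@homo_sorted _ _ (fun k => (t k, s k)) (relpre val leq)) => //.
by rewrite -sorted_map val_enum_ord iota_sorted.
Qed.

(** The product formula needs distinct times, whereas the times of an event may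
    coincide.  Either two observations made at the same time differ, and then both
    the event and its reversal are impossible, or the repeated observations can be
    dropped. *)
Lemma observed_reversible_of_dual (R : realType) (d : measure_display)
    (T : measurableType d) (P : probability T R) (K : nat) (Q : 'M[R]_3)
    (mu : 'rV[R]_3) (Pi : 'M[R]_(3, K)) (C : R -> T -> 'I_3) (S : R -> T -> 'I_K)
    (hCS : hidden_markov_model P Q mu Pi C S) :
  (forall l t, path >%R t (unzip1 l) ->
     filter_before mu (emission_mx Pi) (dual_kernel mu (transition Q)) t l *m const_mx 1 =
     filter_before mu (emission_mx Pi) (transition Q) t l *m const_mx 1 :> 'M[R]_1) ->
  observed_reversible P S.
Proof.
move=> dualE n t s t0 tmono; set a := t ord0 + t ord_max.
pose l0 := [seq (t k, s k) | k <- enum 'I_n.+1].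
pose l := undup l0.
have revE : history S [seq (a - x.1, x.2) | x <- l] =
    path_event S (fun k => a - t k) s.
  rewrite path_event_history; apply: history_eqi => y.
  transitivity (y \in [seq (a - x.1, x.2) | x <- l0]).
    by apply: eq_mem_map => x; rewrite mem_undup.
  by rewrite /l0 -map_comp.
have fwdE : history S l = path_event S t s.
  by rewrite path_event_history; apply: history_eqi => y; rewrite mem_undup.
rewrite -revE -fwdE.
have [/allrelP conf|] := boolP (all2rel (fun x y => (x.1 == y.1) ==> (x == y)) l).
  have linj : {in l &, injective fst}.
    by move=> x y xl yl xy; apply/eqP; have := conf x y xl yl; rewrite xy eqxx.
  have sl := sorted_time_events tmono linj.
  have timeP x : x \in l -> 0 <= x.1 /\ 0 <= a - x.1.
    rewrite mem_undup => /mapP[k _ ->] /=; split.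
      by rewrite (le_trans t0) // tmono.
    rewrite subr_ge0 (le_trans (tmono k ord_max _)) ?leq_ord //.
    by rewrite lerDr.
  have -> : history S l = history S (rev l).
    by apply: history_eqi => x; rewrite mem_rev.
  rewrite (history_reversal hCS (a := a) (l := rev l)) //.
  - by congr (P _); apply: history_eqi => x; rewrite map_rev mem_rev.
  - exact: dualE.
  - by apply/allP => x /mapP[y]; rewrite mem_rev => /timeP[yt _] ->.
  - by apply/allP => x /mapP[y]; rewrite mem_rev => /timeP[_ yt] ->.
rewrite /allrel => /allPn[x xl] /allPn[y yl].
rewrite negb_imply => /andP[/eqP xy1 xy].
have xy2 : x.2 != y.2.
  by apply: contraNneq xy => xy2; rewrite [x]surjective_pairing xy1 xy2 -surjective_pairing.
rewrite (history_conflict S xl yl) //.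
rewrite (@history_conflict _ _ _ S _ (a - x.1, x.2) (a - y.1, y.2)) //=.
- by apply/mapP; exists x.
- by apply/mapP; exists y.
- by rewrite xy1.
Qed.

Lemma observed_reversible_of_underlying (R : realType) (d : measure_display)
    (T : measurableType d) (P : probability T R) (K : nat) (Q : 'M[R]_3)
    (mu : 'rV[R]_3) (Pi : 'M[R]_(3, K)) (C : R -> T -> 'I_3) (S : R -> T -> 'I_K)
    (hCS : hidden_markov_model P Q mu Pi C S) :
  underlying_reversible Q mu -> observed_reversible P S.
Proof.
move=> rev; apply: (observed_reversible_of_dual hCS) => l t _.
suff -> : dual_kernel mu (transition Q) = transition Q by [].
apply/funext => s; apply/matrixP => i j; rewrite mxE.
rewrite -(transition_detailed_balance s i j rev) mulrC mulKf //.
by rewrite gt_eqF //; case: (hmm_positive hCS).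
Qed.

(** The state [h] is the third one; the other two have the same row. *)
Lemma emission_mx_single_state (R : realType) (K : nat) (Pi : 'M[R]_(3, K))
    (i j : 'I_3) :
  i != j -> row i Pi = row j Pi ->
  exists h, forall k,
    emission_mx Pi k = Pi i k *: 1%:M + (Pi h k - Pi i k) *: delta_mx h h.
Proof.
move=> ij rows.
have /cards1P[h hE] : #|~: [set i; j]%SET| == 1%N.
  by rewrite cardsCs finset.setCK cards2 ij card_ord.
have hP x : x != h -> x = i \/ x = j.
  move=> xh; have : x \notin ~: [set i; j]%SET by rewrite hE inE.
  by rewrite !inE negbK => /orP[]/eqP; [left|right].
exists h => k.
have Pix x : x != h -> Pi x k = Pi i k.
  case/hP=> -> //; by move/rowP/(_ k): rows; rewrite !mxE.
apply/matrixP => x y; rewrite !mxE.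
have [<-|xy] := eqVneq x y.
  rewrite andbb !mulr1n mulr1.
  have [->|xh] := eqVneq x h; first by rewrite mulr1 addrC subrK.
  by rewrite mulr0 addr0 Pix.
rewrite !mulr0n mulr0 add0r.
by have [xh|] := eqVneq x h; rewrite ?mulr0 // -xh eq_sym (negPf xy) mulr0.
Qed.

Lemma observed_reversible_of_singular (R : realType) (d : measure_display)
    (T : measurableType d) (P : probability T R) (K : nat) (Q : 'M[R]_3)
    (mu : 'rV[R]_3) (Pi : 'M[R]_(3, K)) (C : R -> T -> 'I_3) (S : R -> T -> 'I_K)
    (hCS : hidden_markov_model P Q mu Pi C S) (i j : 'I_3) :
  i != j -> row i Pi = row j Pi -> observed_reversible P S.
Proof.
move=> ij rows; have [h hE] := emission_mx_single_state ij rows.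
have mu0 a : mu 0 a != 0 by rewrite gt_eqF //; case: (hmm_positive hCS).
have p1 s : transition Q s *m const_mx 1 = const_mx 1 :> 'cV_3.
  by apply: transition_sum1; case: (hmm_rates hCS).
have pD := transition_semigroup hCS.
have mup := hmm_stationary hCS.
apply: (observed_reversible_of_dual hCS) => l t lt.
apply: (@filter_single_state _ _ _ mu (emission_mx Pi) _ _ h (transition Q) _ t l hE) => //.
- by move=> s s' s0 s0'; apply: dual_kernel_semigroup => //; exact: pD.
- by move=> s s0; exact: dual_kernel_stationary.
- by move=> s s0; apply: dual_kernel_sum1 => //; exact: mup.
- by move=> s s0; rewrite mxE mulrC mulKf.
Qed.

(** * Recovering detailed balance from the observations *)

Lemma exists_nonroot (R : numDomainType) (p : {poly R}) :
  p != 0 -> exists x, p.[x] != 0.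
Proof.
move=> p0; pose rs := [seq k%:R : R | k <- iota 0 (size p)].
have : ~~ all (root p) rs.
  apply/negP => /max_poly_roots -/(_ p0); rewrite size_map size_iota ltnn.
  have -> : uniq rs by rewrite map_inj_uniq ?iota_uniq // => m n /eqP; rewrite eqr_nat => /eqP.
  by move=> /(_ isT).
by case/allPn => x _ px; exists x.
Qed.

(** The weights are the powers of a number [x]: the rows become polynomials in [x],
    and [x] is chosen away from the roots of their differences. *)
Lemma exists_separating_weights (R : numFieldType) (n K : nat) (A : 'M[R]_(n, K)) :
  (forall i j, i != j -> row i A <> row j A) ->
  exists w : 'I_K -> R, injective (fun i => \sum_k w k * A i k).
Proof.
move=> Adist; pose q i : {poly R} := \sum_k A i k *: 'X^k.
have coef_q i k : (q i)`_(val k) = A i k.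
  rewrite coef_sum (bigD1 k) //= coefZ coefXn eqxx mulr1 big1 ?addr0 // => l lk.
  by rewrite coefZ coefXn eq_sym val_eqE (negPf lk) mulr0.
have q0 : \prod_i \prod_(j | j != i) (q i - q j) != 0.
  apply/prodf_neq0 => i _; apply/prodf_neq0 => j ji; rewrite subr_eq0.
  apply/eqP => qij; apply: (Adist i j); first by rewrite eq_sym.
  by apply/rowP => k; rewrite !mxE -!coef_q qij.
have [x qx] := exists_nonroot q0; exists (fun k => x ^+ k) => i j fij.
have horner_q l : (q l).[x] = \sum_(k < K) x ^+ k * A l k.
  by rewrite horner_sum; apply: eq_bigr => k _; rewrite hornerZ hornerXn mulrC.
apply/eqP; apply: contraNT qx => ij; rewrite horner_prod.
rewrite (bigD1 i) //= horner_prod (bigD1 j) 1?eq_sym //= hornerD hornerN.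
by rewrite !horner_q fij subrr !mul0r.
Qed.

Lemma sum3 (V : nmodType) (F : 'I_3 -> V) :
  \sum_i F i = F (inord 0) + F (inord 1) + F (inord 2).
Proof.
rewrite !big_ord_recr big_ord0 /= add0r.
by congr (F _ + F _ + F _); apply/val_inj; rewrite /= inordK.
Qed.

(** On three states a circulation is a symmetric flow plus a multiple of the flow
    around the cycle.  On the cyclic part the quadratic expression in [f] is the
    Vandermonde determinant, which does not vanish. *)
Lemma circulation3_symmetric (R : realFieldType) (a : 'I_3 -> 'I_3 -> R) (f : 'I_3 -> R) :
  (forall i, \sum_j a i j = \sum_j a j i) ->
  injective f ->
  \sum_i \sum_j a i j * (f i * f j ^+ 2 - f i ^+ 2 * f j) = 0 ->
  forall i j, a i j = a j i.
Proof.
move=> circ finj; rewrite !sum3.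
have ne x y : x != y -> f x - f y != 0.
  by rewrite subr_eq0 => xy; apply: contra_neq xy => /finj.
have f01 : f (inord 0) - f (inord 1) != 0 by apply: ne; rewrite -val_eqE /= !inordK.
have f02 : f (inord 0) - f (inord 2) != 0 by apply: ne; rewrite -val_eqE /= !inordK.
have f12 : f (inord 1) - f (inord 2) != 0 by apply: ne; rewrite -val_eqE /= !inordK.
have := circ (inord 0); have := circ (inord 1); have := circ (inord 2).
rewrite !sum3.
set i0 := inord 0 : 'I_3; set i1 := inord 1 : 'I_3; set i2 := inord 2 : 'I_3.
move=> c2 c1 c0 flow.
(* [a i0 i1 - a i1 i0] is the net flow around the cycle. *)
have g20 : a i2 i0 = a i0 i2 + (a i0 i1 - a i1 i0) by lra.
have g12 : a i1 i2 = a i2 i1 + (a i0 i1 - a i1 i0) by lra.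
have : (a i0 i1 - a i1 i0) * ((f i0 - f i1) * (f i0 - f i2) * (f i1 - f i2)) = 0.
  rewrite g20 g12 in flow; rewrite -[RHS]oppr0 -flow; ring.
move/eqP; rewrite !mulf_eq0 !(negPf f01) !(negPf f02) !(negPf f12) !orbF subr_eq0.
move/eqP => a01.
have a20 : a i2 i0 = a i0 i2 by rewrite g20 a01 subrr addr0.
have a12 : a i1 i2 = a i2 i1 by rewrite g12 a01 subrr addr0.
have cover (x : 'I_3) : [\/ x = i0, x = i1 | x = i2].
  case: x => [[|[|[|//]]] x3]; [apply: Or31|apply: Or32|apply: Or33];
    by apply/val_inj; rewrite /= inordK.
by move=> i j; case: (cover i) => ->; case: (cover j) => ->.
Qed.

(** Right continuity of the semigroup at [0], in the form needed to merge two
    consecutive observations. *)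
Lemma transition_bilinear_cvg0 (R : realType) (Q : 'M[R]_3) (u : 'rV[R]_3)
    (w : 'cV[R]_3) :
  (u *m transition Q t *m w) 0 0 @[t --> 0^'+] --> (u *m w) 0 0.
Proof.
have -> : (u *m w) 0 0 = \sum_k (\sum_j u 0 j * (j == k)%:R) * w k 0.
  rewrite mxE; apply: eq_bigr => k _; congr (_ * _).
  rewrite (bigD1 k) //= eqxx mulr1 big1 ?addr0 // => j /negPf jk.
  by rewrite jk mulr0.
have -> : (fun t => (u *m transition Q t *m w) 0 0) =
    (fun t => \sum_k (\sum_j u 0 j * transition Q t j k) * w k 0).
  by apply/funext => t; rewrite mxE; apply: eq_bigr => k _; rewrite mxE.
apply: cvg_big => [|k _]; first exact: add_continuous.
apply: cvgM; last exact: cvg_cst.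
apply: cvg_big => [|j _]; first exact: add_continuous.
by apply: cvgM; [exact: cvg_cst|exact: transition_cvg0].
Qed.

Lemma three_time_reversal (R : realType) (d : measure_display)
    (T : measurableType d) (P : probability T R) (K : nat) (Q : 'M[R]_3)
    (mu : 'rV[R]_3) (Pi : 'M[R]_(3, K)) (C : R -> T -> 'I_3) (S : R -> T -> 'I_K)
    (hCS : hidden_markov_model P Q mu Pi C S) (s t : R) (a b c : 'I_K) :
  observed_reversible P S -> 0 < s -> 0 < t ->
  mu *m emission_mx Pi a *m transition Q s *m emission_mx Pi b *m transition Q t
    *m emission_mx Pi c *m const_mx 1 =
  mu *m emission_mx Pi c *m transition Q t *m emission_mx Pi b *m transition Q s
    *m emission_mx Pi a *m const_mx 1 :> 'M[R]_1.
Proof.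
move=> rev s0 t0.
have st0 := addr_gt0 s0 t0.
have p1 v : transition Q v *m const_mx 1 = const_mx 1 :> 'cV_3.
  by apply: transition_sum1; case: (hmm_rates hCS).
have probE (x y z : 'I_K) (u v : R) : 0 < u -> u < v ->
    P (history S [:: (0, x); (u, y); (v, z)]) =
    ((mu *m emission_mx Pi x *m transition Q u *m emission_mx Pi y
      *m transition Q (v - u) *m emission_mx Pi z *m const_mx 1 : 'M[R]_1) 0 0)%:E.
  move=> u0 uv; have v0 := lt_trans u0 uv.
  have -> : history S [:: (0, x); (u, y); (v, z)] = history S [:: (v, z); (u, y); (0, x)].
    by apply: history_eqi => q; rewrite !inE orbA orbC [(q == (u, y)) || _]orbC.
  rewrite (@hmm_history_prob _ _ _ _ _ _ _ _ _ _ hCS _ (v + 1)) /=.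
  - by rewrite subr0 -(mulmxA _ (transition Q (v + 1 - v))) p1.
  - by rewrite ltrDl ltr01 uv u0.
  - by rewrite lexx !ltW.
  - by rewrite addr_ge0 // ltW.
pose time (m : nat) := nth 0 [:: 0; s; s + t] m.
pose symbol (m : nat) := nth a [:: a; b; c] m.
have enumE (F : nat -> R * 'I_K) : [seq F (val k) | k <- enum 'I_3] =
    [:: F 0%N; F 1%N; F 2%N].
  transitivity (map F (map val (enum 'I_3))); first by rewrite -map_comp.
  by rewrite val_enum_ord.
have := rev 2 (fun k => time k) (fun k => symbol k).
rewrite !path_event_history.
rewrite (enumE (fun m => (time m, symbol m))).
rewrite (enumE (fun m => (time 0%N + time 2%N - time m, symbol m))) /time /symbol /=.
have tmono (k l : 'I_3) : (k <= l)%N ->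
    [:: 0; s; s + t]`_k <= [:: 0; s; s + t]`_l.
  case: k l => [[|[|[|//]]] ?] [[|[|[|//]]] ?] //= _; rewrite ?lexx ?ltW //.
  by rewrite ltrDl.
move=> /(_ (lexx 0) tmono).
rewrite add0r subr0 subrr [s + t - s]addrAC subrr add0r.
have -> : history S [:: (s + t, a); (t, b); (0, c)] = history S [:: (0, c); (t, b); (s + t, a)].
  by apply: history_eqi => q; rewrite !inE orbA orbC [(q == (t, b)) || _]orbC.
rewrite !probE ?ltrDl ?ltrDr // [s + t - s]addrAC subrr add0r addrK => -[eq00].
by rewrite [LHS]mx11_scalar [RHS]mx11_scalar eq00.
Qed.

(** Both sides are linear in each of the three occurrences of [F]. *)
Lemma three_time_reversal_combination (R : comPzRingType) (n K : nat)
    (mu : 'rV[R]_n) (A B : 'M[R]_n) (L : 'I_K -> 'M[R]_n) (w : 'I_K -> R) :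
  (forall a b c, mu *m L a *m A *m L b *m B *m L c *m const_mx 1 =
                 mu *m L c *m B *m L b *m A *m L a *m const_mx 1 :> 'M[R]_1) ->
  let F := \sum_k w k *: L k in
  mu *m F *m A *m F *m B *m F *m const_mx 1 =
  mu *m F *m B *m F *m A *m F *m const_mx 1 :> 'M[R]_1.
Proof.
move=> rev F.
have lin1 Y Z : (forall a, mu *m L a *m A *m Y *m B *m Z *m const_mx 1 =
      mu *m Z *m B *m Y *m A *m L a *m const_mx 1 :> 'M[R]_1) ->
    mu *m F *m A *m Y *m B *m Z *m const_mx 1 =
      mu *m Z *m B *m Y *m A *m F *m const_mx 1 :> 'M[R]_1.
  move=> h; rewrite /F !mulmx_sumr !mulmx_suml; apply: eq_bigr => a _.
  by rewrite -!(scalemxAr, scalemxAl) h.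
have lin2 X Z : (forall b, mu *m X *m A *m L b *m B *m Z *m const_mx 1 =
      mu *m Z *m B *m L b *m A *m X *m const_mx 1 :> 'M[R]_1) ->
    mu *m X *m A *m F *m B *m Z *m const_mx 1 =
      mu *m Z *m B *m F *m A *m X *m const_mx 1 :> 'M[R]_1.
  move=> h; rewrite /F !mulmx_sumr !mulmx_suml; apply: eq_bigr => b _.
  by rewrite -!(scalemxAr, scalemxAl) h.
have lin3 X Y : (forall c, mu *m X *m A *m Y *m B *m L c *m const_mx 1 =
      mu *m L c *m B *m Y *m A *m X *m const_mx 1 :> 'M[R]_1) ->
    mu *m X *m A *m Y *m B *m F *m const_mx 1 =
      mu *m F *m B *m Y *m A *m X *m const_mx 1 :> 'M[R]_1.
  move=> h; rewrite /F !mulmx_sumr !mulmx_suml; apply: eq_bigr => c _.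
  by rewrite -!(scalemxAr, scalemxAl) h.
by apply: lin1 => a; apply: lin2 => b; apply: lin3 => c.
Qed.

(** Three observation times suffice: the last two merge in the limit, so that the
    square of [F] is observed although only combinations of the emission matrices
    are available directly; this covers the case in which the emission matrices
    span a space of dimension two. *)
Lemma underlying_reversible_of_observed (R : realType) (d : measure_display)
    (T : measurableType d) (P : probability T R) (K : nat) (Q : 'M[R]_3)
    (mu : 'rV[R]_3) (Pi : 'M[R]_(3, K)) (C : R -> T -> 'I_3) (S : R -> T -> 'I_K)
    (hCS : hidden_markov_model P Q mu Pi C S) :
  observed_reversible P S -> regular Pi -> underlying_reversible Q mu.
Proof.
move=> rev reg i0 j0; apply: rates_detailed_balance => t t0.
have [w finj] := exists_separating_weights reg.
pose f i := \sum_k w k * Pi i k.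
pose F := \sum_k w k *: emission_mx Pi k.
have FE : F = diag_mx (\row_i f i).
  apply/matrixP => i j; rewrite summxE !mxE.
  under eq_bigr do rewrite !mxE mulrnAr.
  by rewrite -sumrMnl.
have three s : 0 < s ->
    mu *m F *m transition Q t *m F *m transition Q s *m F *m const_mx 1 =
    mu *m F *m transition Q s *m F *m transition Q t *m F *m const_mx 1 :> 'M[R]_1.
  move=> s0; apply: three_time_reversal_combination => a b c.
  exact: (three_time_reversal hCS).
clearbody F.
have two : mu *m F *m transition Q t *m F *m F *m const_mx 1 =
           mu *m F *m F *m transition Q t *m F *m const_mx 1 :> 'M[R]_1.
  rewrite [LHS]mx11_scalar [RHS]mx11_scalar; congr (_%:M).
  have lhs := @transition_bilinear_cvg0 R Q (mu *m F *m transition Q t *m F) (F *m const_mx 1).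
  have rhs := @transition_bilinear_cvg0 R Q (mu *m F) (F *m transition Q t *m F *m const_mx 1).
  move: lhs rhs; rewrite !mulmxA => lhs rhs.
  apply: (cvg_unique (@Rhausdorff R) lhs); apply: cvg_trans rhs.
  apply: near_eq_cvg; near=> s.
  have s0 : 0 < s by near: s; exact: nbhs_right_gt.
  by move: (transition Q s) (three s s0) => ps; rewrite !mulmxA => ->.
pose a i j := mu 0 i * transition Q t i j.
apply: (@circulation3_symmetric R a f) => //.
- move=> i; rewrite -mulr_sumr.
  have p1 : transition Q t *m const_mx 1 = const_mx 1 :> 'cV_3.
    by apply: transition_sum1; case: (hmm_rates hCS).
  have /colP/(_ i) := p1; rewrite !mxE; under eq_bigr do rewrite mxE mulr1.
  move=> ->; have /rowP/(_ i) := hmm_stationary hCS (ltW t0).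
  by rewrite mxE mulr1 => ->.
have /matrixP/(_ 0 0) := two; rewrite FE.
have rowF (v : 'rV[R]_3) : v *m diag_mx (\row_i f i) = \row_i (v 0 i * f i).
  by apply/rowP => i; rewrite mul_mx_diag !mxE.
rewrite !rowF [LHS]mxE [RHS]mxE => /eqP; rewrite -subr_eq0 -sumrB => /eqP bal.
rewrite -[RHS]bal exchange_big /=; apply: eq_bigr => j _.
rewrite !mxE !mulr1 !mulr_suml -sumrB; apply: eq_bigr => i _.
by rewrite !mxE /a; ring.
Unshelve. all: by end_near. Qed.

Theorem theorem3p4 (R : realType) (d : measure_display) (T : measurableType d)
    (P : probability T R) (K : nat)
    (Q : 'M[R]_3) (mu : 'rV[R]_3) (Pi : 'M[R]_(3, K))
    (C : R -> T -> 'I_3) (S : R -> T -> 'I_K)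
    (hCS : hidden_markov_model P Q mu Pi C S) :
  observed_irreversible P S <-> (underlying_irreversible Q mu /\ regular Pi).
Proof.
split => [irr|[uirr reg] rev].
  split; first by move=> urev; apply: irr; exact: (observed_reversible_of_underlying hCS).
  move=> i j ij rows; apply: irr.
  exact: (observed_reversible_of_singular hCS ij rows).
by apply: uirr; exact: (underlying_reversible_of_observed hCS).
Qed.
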